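(* Let $(X,d)$ be a compact metric space, let $\varphi:\mathbb{R}_0^+\times X\to X$ be a continuous semiflow and let $f:X\to\mathbb{R}$ be a continuous potential. Then $$P(\varphi,f)=\overline{P}_r(\varphi,f)=\overline{P}_s(\varphi,f)=\hat{P}_r(\varphi,f)=\hat{P}_s(\varphi,f).$$
   Context: A semiflow on $X$ is a map $\varphi:\mathbb{R}_0^+\times X\to X$, written $\varphi(t,x)=\varphi_t(x)$, with $\varphi_0(x)=x$ and $\varphi_{s+t}(x)=\varphi_s(\varphi_t(x))$ for all $s,t\ge 0$, $x\in X$. It is continuous if it is continuous as a map on $\mathbb{R}_0^+\times X$. Classical pressure. For $\varepsilon>0$, $T>0$: $E\subset X$ is $(\varphi,T,\varepsilon)$-spanning if for every $x\in X$ there is $y\in E$ with $d(\varphi_t(x),\varphi_t(y))<\varepsilon$ for all $t\in[0,T]$; $F\subset X$ is $(\varphi,T,\varepsilon)$-separated if for all $x_1\ne x_2$ in $F$ there is $t\in[0,T]$ with $d(\varphi_t(x_1),\varphi_t(x_2))\ge\varepsilon$. Let $Z_r(\varphi,f,\varepsilon,T)=\inf_E\sum_{x\in E}\exp\left(\int_0^Tf(\varphi_s(x))ds\right)$ over $(\varphi,T,\varepsilon)$-spanning sets $E$, and $Z_s(\varphi,f,\varepsilon,T)=\sup_F\sum_{x\in F}\exp\left(\int_0^Tf(\varphi_s(x))ds\right)$ over $(\varphi,T,\varepsilon)$-separated sets $F$. For $\ast\in\{r,s\}$ set $P_\ast(\varphi,f)=\lim_{\varepsilon\to0^+}\limsup_{T\to\infty}\frac1T\log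 Z_\ast(\varphi,f,\varepsilon,T)$. For a continuous semiflow on a compact metric space it is classical that $P_r(\varphi,f)=P_s(\varphi,f)$; this common value is $P(\varphi,f)$. New pressures. For $\delta>0$ let $\hat d_\delta(x,y)=\inf\{d(\varphi_s(x),\varphi_s(y)):s\in[0,\delta)\}$ and $\overline d_\delta(x,y)=\inf\{d(\varphi_{s_1}(x),\varphi_{s_2}(y)):s_1,s_2\in[0,\delta)\}$. A set $E\subset X$ is $(\varphi,T,\varepsilon,\delta)$-spanning with respect to $\overline d_\delta$ if for every $x\in X$ there is $y\in E$ with $\overline d_\delta(\varphi_t(x),\varphi_t(y))<\varepsilon$ for all $t\in[0,T]$; $F\subset X$ is $(\varphi,T,\varepsilon,\delta)$-separated with respect to $\overline d_\delta$ if for all $x_1\neq x_2$ in $F$ there is $t\in[0,T]$ with $\overline d_\delta(\varphi_t(x_1),\varphi_t(x_2))\ge\varepsilon$. Let $\overline Z_r(\varphi,f,\varepsilon,\delta,T)$ be the infimum of $\sum_{x\in E}\exp\left(\int_0^Tf(\varphi_s(x))ds\right)$ over $(\varphi,T,\varepsilon,\delta)$-spanning sets $E$ w.r.t. $\overline d_\delta$, and $\overline Z_s(\varphi,f,\varepsilon,\delta,T)$ the supremum of $\sum_{x\in F}\exp\left(\int_0^Tf(\varphi_s(x))ds\right)$ over $(\varphi,T,\varepsilon,\delta)$-separated sets $F$ w.r.t. $\overline d_\delta$. For $\ast\in\{r,s\}$, $$\overline P_\ast(\varphi,f)=\lim_{\delta\to0^+}\lim_{\varepsilon\to0^+}\limsup_{T\to\infty}\frac1T\log\overline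 Z_\ast(\varphi,f,\varepsilon,\delta,T)$$ (the limits exist by monotonicity). Replacing $\overline d_\delta$ by $\hat d_\delta$ everywhere gives $\hat Z_r,\hat Z_s$ and $\hat P_r(\varphi,f),\hat P_s(\varphi,f)$. Sums over infinite sets are taken in $[0,+\infty]$ and pressures in $[-\infty,+\infty]$. *)

(* Defs.v *)
From HB Require Import structures.
From mathcomp Require Import all_boot all_order all_algebra.
From mathcomp Require Import all_classical all_reals all_analysis.

Set Implicit Arguments.
Unset Strict Implicit.
Unset Printing Implicit Defensive.
Import Order.TTheory GRing.Theory Num.Theory.
Import numFieldNormedType.Exports.
Local Open Scope classical_set_scope.
Local Open Scope ring_scope.

(* Time is a real parameter, but only the values [phi t x] with [0 <= t] are
   ever constrained or used: no assumption is made at negative times. *)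
Definition semiflow (R : realType) (X : Type) (phi : R -> X -> X) : Prop :=
  (forall x, phi 0 x = x) /\
  (forall s t x, 0 <= s -> 0 <= t -> phi (s + t) x = phi s (phi t x)).

Definition continuous_semiflow (R : realType) (X : metricType R)
    (phi : R -> X -> X) : Prop :=
  semiflow phi /\
  {within `[0, +oo[%classic `*` [set: X],
    continuous (fun p : R * X => phi p.1 p.2)}.

Section Pressure.
Context {R : realType} {X : metricType R}.
Variables (phi : R -> X -> X) (f : X -> R).

Definition dhat (delta : R) (x y : X) : R :=
  inf [set mdist (phi s x) (phi s y) | s in `[0, delta[].

Definition dbar (delta : R) (x y : X) : R :=
  inf [set mdist (phi s1 x) (phi s2 y) | s1 in `[0, delta[ & s2 in `[0, delta[].

(* [rho] is one of [mdist], [dhat delta] and [dbar delta]; the last two need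
   not satisfy the triangle inequality. *)

Definition spanning (rho : X -> X -> R) (T eps : R) (E : set X) : Prop :=
  forall x, exists2 y, E y &
    forall t, t \in `[0, T] -> rho (phi t x) (phi t y) < eps.

Definition separated (rho : X -> X -> R) (T eps : R) (F : set X) : Prop :=
  forall x1 x2, F x1 -> F x2 -> x1 <> x2 ->
    exists2 t, t \in `[0, T] & eps <= rho (phi t x1) (phi t x2).

Definition weight (T : R) (x : X) : R :=
  expR (\int[lebesgue_measure]_(s in `[0, T]) f (phi s x)).

Definition Zspan (rho : X -> X -> R) (eps T : R) : \bar R :=
  ereal_inf [set (\esum_(x in E) (weight T x)%:E)%E | E in spanning rho T eps].

Definition Zsep (rho : X -> X -> R) (eps T : R) : \bar R :=
  ereal_sup [set (\esum_(x in F) (weight T x)%:E)%E | F in separated rho T eps].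

Definition growth_rate (Z : R -> \bar R) : \bar R :=
  limf_esup (fun T : R => (T^-1)%:E * lne (Z T))%E (pinfty_nbhs R).

(* All limits below are limits of functions that are monotone in [eps], resp.
   in [delta], so they exist in [\bar R]. *)

Definition pressure_span : \bar R :=
  lim (growth_rate (Zspan mdist eps) @[eps --> 0^'+]).

Definition pressure_sep : \bar R :=
  lim (growth_rate (Zsep mdist eps) @[eps --> 0^'+]).

Definition pressure_bar_span : \bar R :=
  lim (lim (growth_rate (Zspan (dbar delta) eps) @[eps --> 0^'+])
    @[delta --> 0^'+]).

Definition pressure_bar_sep : \bar R :=
  lim (lim (growth_rate (Zsep (dbar delta) eps) @[eps --> 0^'+])
    @[delta --> 0^'+]).

Definition pressure_hat_span : \bar R :=
  lim (lim (growth_rate (Zspan (dhat delta) eps) @[eps --> 0^'+])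
    @[delta --> 0^'+]).

Definition pressure_hat_sep : \bar R :=
  lim (lim (growth_rate (Zsep (dhat delta) eps) @[eps --> 0^'+])
    @[delta --> 0^'+]).

End Pressure.

(* Main.v *)
Require Import Defs.
From HB Require Import structures.
From mathcomp Require Import all_boot all_order all_algebra.
From mathcomp Require Import all_classical all_reals all_analysis.
From mathcomp Require Import lra.
Import Order.TTheory GRing.Theory Num.Theory.
Import numFieldNormedType.Exports.
Local Open Scope classical_set_scope.
Local Open Scope ring_scope.

(** Write [d] for the distance of [X]. Two facts carry the proof.

    The relaxed distances see the same dynamics as [d]. By compactness of [X]
    and continuity of the semiflow at time 0, points move by less than any
    given [eta] during a time interval [[0, delta)], uniformly on [X]
    ([displacement_small]). The triangle inequality then gives
    [d - 2 eta <= dbar delta <= dhat delta <= d] for small [delta]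
    ([mdist_le_dbar], [dbar_le_dhat], [dhat_le_mdist]): the relaxation costs
    an additive error that vanishes with [delta]. Hence a set that is spanning
    or separated for one of the three at some scale is so for the others at a
    nearby scale. All limits are suprema of antitone functions, so the shift
    of scale disappears when [eps] and then [delta] tend to 0. This argument
    rests on the monotonicity of the partition function in the relation
    [rho x y < eps], so it serves spanning and separated sets, and [dhat] and
    [dbar], at once ([pressure_insensitive]).

    The two classical pressures agree. A maximal separated set is spanning,
    whence [Zspan <= Zsep] ([Zspan_le_Zsep]). Conversely, sending each point
    of an [eps]-separated set to a point of an [eps / 2]-spanning set that
    follows its orbit is injective. If [f] varies by at most [a] at the
    spanning scale, this changes each weight by a factor at most [expR (a T)],
    which adds at most [a] to the growth rate ([Zsep_le_Zspan]), and [a] is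
    arbitrary since [f] is uniformly continuous ([uniform_modulus]). *)

(** * Limits at 0 and exponential growth rates *)

Lemma lim_at_right0_sup (R : realType) (g : R -> \bar R) :
  (forall e e', 0 < e -> e <= e' -> (g e' <= g e)%E) ->
  lim (g e @[e --> 0^'+]) = ereal_sup [set g e | e in `]0, +oo[].
Proof.
move=> gmono; apply: cvg_lim => //; apply: nonincreasing_at_right_cvge => //.
by move=> e e'; rewrite in_itv/= andbT => e0 _; exact: gmono.
Qed.

Lemma lim_at_right0_ge (R : realType) (g : R -> \bar R) (e : R) :
  (forall e e', 0 < e -> e <= e' -> (g e' <= g e)%E) ->
  0 < e -> (g e <= lim (g e @[e --> 0^'+]))%E.
Proof.
move=> gmono e0; rewrite lim_at_right0_sup//; apply: ereal_sup_ubound.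
by exists e => //; rewrite /= in_itv/= e0.
Qed.

Lemma lim_at_right0_le (R : realType) (g : R -> \bar R) (l : \bar R) :
  (forall e e', 0 < e -> e <= e' -> (g e' <= g e)%E) ->
  (forall e, 0 < e -> (g e <= l)%E) -> (lim (g e @[e --> 0^'+]) <= l)%E.
Proof.
move=> gmono gl; rewrite lim_at_right0_sup//.
apply: ge_ereal_sup => _ /= [e + <-].
by rewrite in_itv/= andbT => e0; exact: gl.
Qed.

(** A factor [expR (a T)] in the partition function becomes a summand [a] in
    the growth rate; this is how the oscillation of the potential along
    shadowing orbits enters the comparison of pressures. *)
Lemma growth_rate_le (R : realType) (a : R) (Z1 Z2 : R -> \bar R) :
  (forall T, 0 <= Z1 T)%E -> (forall T, 0 <= Z2 T)%E ->
  (forall T, 0 < T -> (Z1 T <= (expR (a * T))%:E * Z2 T)%E) ->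
  (growth_rate Z1 <= a%:E + growth_rate Z2)%E.
Proof.
move=> Z10 Z20 Z12; rewrite -leeBlDl// {2}/growth_rate limf_esupE.
apply: le_ereal_inf_tmp => _ [V FV <-].
rewrite leeBlDl// /growth_rate limf_esupE; apply: ge_ereal_inf.
exists (ereal_sup
  [set ((T^-1)%:E * lne (Z1 T))%E | T in V `&` [set T | 0 < T]]).
  exists (V `&` [set T | 0 < T]) => //; apply: filterI => //.
  by apply: nbhs_pinfty_gt; rewrite num_real.
apply: ge_ereal_sup => _ [T [VT /= T0] <-].
have step : (lne (Z1 T) <= (a * T)%:E + lne (Z2 T))%E.
  apply: (@le_trans _ _ (lne ((expR (a * T))%:E * Z2 T))).
    rewrite lee_lne ?in_itv/= ?leey ?Z10 ?mule_ge0 ?lee_fin ?expR_ge0//.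
    exact: Z12.
  have := Z20 T; rewrite le_eqVlt => /predU1P[<-|Z2T].
    by rewrite mule0 le0_lneNy.
  rewrite lneM; first by rewrite lne_EFin ?expR_gt0// expRK.
    by rewrite in_itv/= lte_fin expR_gt0 leey.
  by rewrite in_itv/= Z2T leey.
apply: (@le_trans _ _ ((T^-1)%:E * ((a * T)%:E + lne (Z2 T)))%E).
  by rewrite lee_pmul2l// lte_fin invr_gt0.
rewrite muleDr// -EFinM mulrC mulfK ?gt_eqF// leeD2l//.
by apply: ereal_sup_ubound; exists T.
Qed.

Lemma growth_rate_mono (R : realType) (Z1 Z2 : R -> \bar R) :
  (forall T, 0 <= Z1 T)%E -> (forall T, Z1 T <= Z2 T)%E ->
  (growth_rate Z1 <= growth_rate Z2)%E.
Proof.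
move=> Z10 Z12; rewrite -[leRHS]add0e; apply: growth_rate_le => // T.
  exact: le_trans (Z12 T).
by rewrite mul0r expR0 mul1e.
Qed.

(** * Partition functions *)

Lemma esum_subset (R : realType) (T : choiceType) (A B : set T)
    (a : T -> \bar R) :
  A `<=` B -> (\esum_(x in A) a x <= \esum_(x in B) a x)%E.
Proof.
move=> AB; apply: ereal_sup_le => _ [K [finK KA] <-].
by exists K => //; split => //; exact: subset_trans AB.
Qed.

Lemma esumZl_le (R : realType) (T : choiceType) (A : set T) (c : R)
    (a : T -> \bar R) :
  0 <= c -> (forall x, 0 <= a x)%E ->
  (\esum_(x in A) (c%:E * a x) <= c%:E * \esum_(x in A) a x)%E.
Proof.
move=> c0 a0; apply: ge_ereal_sup => _ [K [finK KA] <-].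
rewrite -ge0_mule_fsumr//; apply: lee_wpmul2l => //.
by apply: ereal_sup_ubound; exists K.
Qed.

Section PartitionFunctions.
Context {R : realType} {X : metricType R}.
Variables (phi : R -> X -> X) (f : X -> R).

Lemma weight_gt0 T x : 0 < weight phi f T x.
Proof. exact: expR_gt0. Qed.

Lemma Zspan_ge0 rho e T : (0 <= Zspan phi f rho e T)%E.
Proof.
apply: le_ereal_inf_tmp => _ [E _ <-]; apply: esum_ge0 => x _.
by rewrite lee_fin ltW// weight_gt0.
Qed.

Lemma Zsep_ge0 rho e T : (0 <= Zsep phi f rho e T)%E.
Proof. by apply: ereal_sup_ubound; exists set0; rewrite ?esum_set0. Qed.

(** Spanning and separation depend on [rho] and [eps] through the relation
    [rho x y < eps] only. A smaller relation gives fewer spanning sets, hence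
    a larger infimum, and more separated sets, hence a larger supremum: both
    partition functions move in the same direction. *)
Lemma Zspan_le (rho rho' : X -> X -> R) e e' T :
  (forall x y, rho' x y < e' -> rho x y < e) ->
  (Zspan phi f rho e T <= Zspan phi f rho' e' T)%E.
Proof.
move=> rr; apply: ereal_inf_le_tmp => _ [E spE <-]; exists E => // x.
by have [y Ey xy] := spE x; exists y => // t tT; exact/rr/xy.
Qed.

Lemma Zsep_le (rho rho' : X -> X -> R) e e' T :
  (forall x y, rho' x y < e' -> rho x y < e) ->
  (Zsep phi f rho e T <= Zsep phi f rho' e' T)%E.
Proof.
move=> rr; apply: ereal_sup_le => _ [F spF <-]; exists F => // x y Fx Fy xy.
have [t tT le_e] := spF x y Fx Fy xy; exists t => //.
by rewrite leNgt; apply: contraL le_e => /rr; rewrite -ltNge.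
Qed.

(** A maximal separated set is spanning: a point that it does not shadow could
    be added to it. Zorn's lemma provides one, since two points of the union of
    a chain already lie together in a member of the chain. *)
Lemma Zspan_le_Zsep (rho : X -> X -> R) e T :
  (forall x, rho x x < e) -> (forall x y, rho x y = rho y x) ->
  (Zspan phi f rho e T <= Zsep phi f rho e T)%E.
Proof.
move=> rxx rsym.
have [F [sepF maxF]] : exists F, Defs.separated phi rho T e F /\
    forall G, F `<` G -> ~ Defs.separated phi rho T e G.
  apply: Zorn_bigcup => C Csep Ctot x y [A CA Ax] [B CB By].
  by case: (Ctot A B CA CB) => [AB|BA];
    [apply: (Csep B) => //; exact: AB|apply: (Csep A) => //; exact: BA].
apply: (@le_trans _ _ (\esum_(x in F) (weight phi f T x)%:E)%E); last first.
  by apply: ereal_sup_ubound; exists F.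
apply: ereal_inf_lbound; exists F => // x; apply: contrapT => xF.
(* If no point of [F] shadows [x], then [x] is separated from all of [F]. *)
have far y : F y -> exists2 t, t \in `[0, T] & e <= rho (phi t x) (phi t y).
  move=> Fy; apply: contrapT => nt; apply: xF; exists y => // t tT.
  by rewrite ltNge; apply/negP => le_e; apply: nt; exists t.
apply: (maxF (x |` F)).
  split; first by move=> y Fy; right.
  by move=> /(_ x (or_introl erefl)) /far[t _]; rewrite leNgt rxx.
move=> y z [->|Fy] [->|Fz] // yz; [exact: far| |exact: sepF].
by have [t tT] := far _ Fy; rewrite rsym; exists t.
Qed.

End PartitionFunctions.

(** * Insensitivity of the pressure to small perturbations of the distance *)

(** If [rho delta] lies between [d - eta] and [d], then the scale-[e / 2]
    quantity for [rho delta] dominates the scale-[e] quantity for [d] as soon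
    as [eta <= e / 2], while it never exceeds the one for [d] at its own
    scale. *)
Lemma pressure_insensitive {R : realType} {X : metricType R}
    (Z : (X -> X -> R) -> R -> R -> \bar R) (rho : R -> X -> X -> R) :
  (forall d e T, 0 <= Z d e T)%E ->
  (forall d d' e e' T, (forall x y, d' x y < e' -> d x y < e) ->
    (Z d e T <= Z d' e' T)%E) ->
  (forall delta delta' x y, 0 < delta -> delta <= delta' ->
    rho delta' x y <= rho delta x y) ->
  (forall delta x y, 0 < delta -> rho delta x y <= mdist x y) ->
  (forall eta, 0 < eta -> exists2 delta, 0 < delta &
    forall x y, mdist x y <= rho delta x y + eta) ->
  lim (lim (growth_rate (Z (rho delta) eps) @[eps --> 0^'+])
    @[delta --> 0^'+]) = lim (growth_rate (Z mdist eps) @[eps --> 0^'+]).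
Proof.
move=> Z0 Zle rho_anti rho_le rho_ge.
have growth_le d d' e e' : (forall x y, d' x y < e' -> d x y < e) ->
    (growth_rate (Z d e) <= growth_rate (Z d' e'))%E.
  by move=> dd; apply: growth_rate_mono => // T; exact: Zle.
have eps_anti d e e' : 0 < e -> e <= e' ->
    (growth_rate (Z d e') <= growth_rate (Z d e))%E.
  by move=> _ ee; apply: growth_le => x y /lt_le_trans; exact.
have lim_le d d' : (forall x y, d x y <= d' x y) ->
    (lim (growth_rate (Z d eps) @[eps --> 0^'+]) <=
     lim (growth_rate (Z d' eps) @[eps --> 0^'+]))%E.
  move=> dd; apply: lim_at_right0_le => [|e e0]; first exact: eps_anti.
  apply: le_trans (lim_at_right0_ge _
    (fun e => growth_rate (Z d' e)) _ (eps_anti d') e0).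
  by apply: growth_le => x y; exact: le_lt_trans.
have delta_anti delta delta' : 0 < delta -> delta <= delta' ->
    (lim (growth_rate (Z (rho delta') eps) @[eps --> 0^'+]) <=
     lim (growth_rate (Z (rho delta) eps) @[eps --> 0^'+]))%E.
  by move=> delta0 dd; apply: lim_le => x y; exact: rho_anti.
apply/eqP; rewrite eq_le; apply/andP; split.
  apply: lim_at_right0_le => // delta delta0.
  by apply: lim_le => x y; exact: rho_le.
apply: lim_at_right0_le => [|e e0]; first exact: eps_anti.
have e20 : 0 < e / 2 by lra.
have [delta delta0 le_rho] := rho_ge _ e20.
apply: le_trans (lim_at_right0_ge _
  (fun delta => lim (growth_rate (Z (rho delta) eps) @[eps --> 0^'+]))
  _ delta_anti delta0).
apply: (@le_trans _ _ (growth_rate (Z (rho delta) (e / 2)))).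
  by apply: growth_le => x y; have := le_rho x y; lra.
apply: (lim_at_right0_ge _ (fun e => growth_rate (Z (rho delta) e)) _ _ e20).
exact: eps_anti.
Qed.

(** * Uniformity from compactness *)

Section Semiflow.
Context {R : realType} {X : metricType R}.
Variables (phi : R -> X -> X) (f : X -> R).
Hypothesis compactX : compact [set: X].
Hypothesis phi_semiflow : continuous_semiflow phi.
Hypothesis f_continuous : continuous f.

Lemma semiflow_continuous_at s x : 0 <= s -> forall e, 0 < e ->
  exists2 r, 0 < r & forall t y, 0 <= t -> `|s - t| < r -> mdist x y < r ->
    mdist (phi s x) (phi t y) < e.
Proof.
move=> s0 e e0; have [_ /subspace_continuousP/(_ (s, x))] := phi_semiflow.
rewrite /= in_itv/= s0 => /(_ (conj isT I)).
move=> /metricType_numDomainType.cvgrPdist_lt/(_ e e0)/=.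
rewrite near_withinE => -[[U V]/= [/nbhs_ballP[r1 /= r10 rU]]].
move=> /nbhs_ballP[r2 /= r20 rV] UV; exists (Num.min r1 r2) => [|t y t0 st xy].
  by rewrite lt_min r10.
apply: (UV (t, y)) => /=; last by rewrite in_itv/= t0.
split; [apply: rU|apply: rV; rewrite ballEmdist/=].
  by rewrite /ball/= (lt_le_trans st)// ge_min lexx.
by rewrite (lt_le_trans xy)// ge_min lexx orbT.
Qed.

Lemma displacement_small eta : 0 < eta -> exists2 delta, 0 < delta &
  forall s x, 0 <= s < delta -> mdist x (phi s x) < eta.
Proof.
move=> eta0; have [[phi0 _] _] := phi_semiflow.
have /compact_near_coveringP cover := compactX.
have : \forall delta \near 0^'+,
    [set: X] `<=`
      (fun x => forall s, 0 <= s < delta -> mdist x (phi s x) < eta).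
  apply: cover => x _; have eta20 : 0 < eta / 2 by lra.
  have [r r0 near_r] := semiflow_continuous_at 0 x (lexx 0) _ eta20.
  rewrite phi0 in near_r.
  have m0 : 0 < Num.min r (eta / 2) by rewrite lt_min r0.
  near=> y delta.
  have xy : mdist x y < Num.min r (eta / 2).
    suff : ball x (Num.min r (eta / 2)) y by rewrite ballEmdist.
    by near: y; exact: nbhsx_ballx.
  have delta_r : delta < r by near: delta; exact: nbhs_right_lt.
  move=> s /andP[s0 sd]; have sr := lt_trans sd delta_r.
  move: xy; rewrite lt_min => /andP[xr xe].
  apply: (le_lt_trans (metric_triangle _ x _)).
  have := near_r s y s0; rewrite sub0r normrN ger0_norm// => /(_ sr xr).
  by rewrite (metric_sym y); lra.
move=> small; near (0 : R)^'+ => delta; exists delta => [//|s x sd].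
by apply: (near small delta).
Unshelve. all: by end_near. Qed.

Lemma uniform_modulus a : 0 < a -> exists2 e, 0 < e &
  forall x y, mdist x y < e -> f x <= f y + a.
Proof.
move=> a0; have /compact_near_coveringP cover := compactX.
have : \forall e \near 0^'+,
    [set: X] `<=` (fun x => forall y, mdist x y < e -> f x <= f y + a).
  apply: cover => x _; have a20 : 0 < a / 2 by lra.
  have [r r0 fr] : exists2 r : R, 0 < r &
      forall y, mdist x y < r -> `|f x - f y| < a / 2.
    have /cvgrPdist_lt/(_ _ a20)/nbhs_ballP[r r0 fr] := f_continuous x.
    by exists r => // y xy; apply: fr; rewrite ballEmdist.
  have r20 : 0 < r / 2 by lra.
  near=> y e.
  have xy : mdist x y < r / 2.
    suff : ball x (r / 2) y by rewrite ballEmdist.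
    by near: y; exact: nbhsx_ballx.
  have er : e < r / 2 by near: e; exact: nbhs_right_lt.
  move=> z yz.
  have xr : mdist x y < r by apply: lt_trans xy _; lra.
  have xz : mdist x z < r.
    apply: (le_lt_trans (metric_triangle x y z)).
    by rewrite [ltRHS]splitr ltrD// (lt_trans yz er).
  by move: (fr _ xr) (fr _ xz); rewrite !ltr_norml; lra.
move=> small; near (0 : R)^'+ => e; exists e => [//|x y xy].
by apply: (near small e) xy.
Unshelve. all: by end_near. Qed.

(** * Coincidence of the two classical pressures *)

Lemma potential_integrable T x :
  lebesgue_measure.-integrable `[0, T] (EFin \o (fun s => f (phi s x))).
Proof.
apply: continuous_compact_integrable; first exact: segment_compact.
apply/subspace_continuousP => s /=; rewrite in_itv/= => /andP[s0 sT].
apply: (@cvg_comp _ _ _ (phi ^~ x) f); last exact: f_continuous.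
apply/metricType_numDomainType.cvgrPdist_lt => e e0.
have [r r0 near_r] := semiflow_continuous_at s x s0 e e0.
rewrite near_withinE; exists r => // t /= st; rewrite in_itv/= => /andP[t0 _].
by apply: near_r => //; rewrite mdistxx.
Qed.

Lemma weight_le T a x y : 0 <= T ->
  (forall t, t \in `[0, T] -> f (phi t x) <= f (phi t y) + a) ->
  weight phi f T x <= expR (a * T) * weight phi f T y.
Proof.
move=> T0 fxy; rewrite /weight -expRD ler_expR.
have -> : a * T = \int[lebesgue_measure]_(s in `[0, T]) a.
  rewrite Rintegral_cst//= lebesgue_measure_itv/= lte_fin.
  by have [_|T_le0] := ltP 0 T; [rewrite /= subr0|have -> : T = 0 by lra].
have inta : lebesgue_measure.-integrable `[0, T] (EFin \o (fun _ : R => a)).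
  apply: continuous_compact_integrable; first exact: segment_compact.
  by move=> ?; exact: cvg_cst.
have intx := potential_integrable T.
rewrite addrC -RintegralD//; apply: le_Rintegral => //.
have := integrableD _ (intx y) inta; apply; exact: measurable_itv.
Qed.

(** Two points of an [e]-separated set cannot be shadowed by the same orbit
    within [e' <= e / 2], so choosing a shadowing point of a spanning set is
    injective, and it changes each weight by a factor at most [expR (a T)]. *)
Lemma Zsep_le_Zspan e e' a T : 0 <= T -> 2 * e' <= e ->
  (forall x y, mdist x y < e' -> f x <= f y + a) ->
  (Zsep phi f mdist e T <=
    (expR (a * T))%:E * Zspan phi f mdist e' T)%E.
Proof.
move=> T0 ee' fmod; apply: ge_ereal_sup => _ [F sepF <-].
rewrite -lee_pdivrMl ?expR_gt0//; apply: le_ereal_inf_tmp => _ [E spE <-].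
rewrite lee_pdivrMl ?expR_gt0//.
have /choice[p pP] : forall x, exists y, E y /\
    forall t, t \in `[0, T] -> mdist (phi t x) (phi t y) < e'.
  by move=> x; have [y] := spE x; exists y.
have injp : set_inj F p.
  move=> x y /set_mem Fx /set_mem Fy pxy; apply: contrapT => nxy.
  have [t tT] := sepF x y Fx Fy nxy; apply/negP; rewrite -ltNge.
  apply: (le_lt_trans (metric_triangle _ (phi t (p x)) _)).
  have := (pP x).2 t tT; have := (pP y).2 t tT.
  rewrite -pxy (metric_sym _ (phi t y)); lra.
apply: (@le_trans _ _ ((expR (a * T))%:E *
    \esum_(x in F) (weight phi f T (p x))%:E)%E).
  apply: le_trans (esumZl_le _ _ _ _ _ (expR_ge0 _) _) => [|x]; last first.
    by rewrite lee_fin ltW// weight_gt0.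
  apply: le_esum => x Fx; rewrite -EFinM lee_fin; apply: weight_le => // t tT.
  exact/fmod/(pP x).2.
rewrite lee_pmul2l ?lte_fin ?expR_gt0//.
rewrite -(esum_image _ _ (fun y => (weight phi f T y)%:E))//.
by apply: esum_subset => _ [x _ <-]; exact: (pP x).1.
Qed.

Lemma pressure_sepE : pressure_sep phi f = pressure_span phi f.
Proof.
have span_anti e e' : 0 < e -> e <= e' ->
    (growth_rate (Zspan phi f mdist e') <= growth_rate (Zspan phi f mdist e))%E.
  move=> _ ee; apply: growth_rate_mono => T; first exact: Zspan_ge0.
  by apply: Zspan_le => x y /lt_le_trans; exact.
have sep_anti e e' : 0 < e -> e <= e' ->
    (growth_rate (Zsep phi f mdist e') <= growth_rate (Zsep phi f mdist e))%E.
  move=> _ ee; apply: growth_rate_mono => T; first exact: Zsep_ge0.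
  by apply: Zsep_le => x y /lt_le_trans; exact.
apply/eqP; rewrite eq_le; apply/andP; split; apply: lim_at_right0_le => // e e0.
  apply/lee_addgt0Pr => a a0; have [r r0 fmod] := uniform_modulus a a0.
  (* [r] controls the oscillation of [f]; [e / 2] makes shadowing injective. *)
  pose e' := Num.min r (e / 2).
  have e'0 : 0 < e' by rewrite lt_min r0; lra.
  apply: (@le_trans _ _ (a%:E + growth_rate (Zspan phi f mdist e'))%E).
    apply: growth_rate_le => [T|T|T T0]; [exact: Zsep_ge0|exact: Zspan_ge0|].
    apply: Zsep_le_Zspan; first exact: ltW.
      have : e' <= e / 2 by rewrite ge_min lexx orbT.
      lra.
    by move=> x y xy; apply: fmod; apply: lt_le_trans xy _; rewrite ge_min lexx.
  by rewrite addeC leeD2r//;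
    exact: (lim_at_right0_ge _ (fun e => growth_rate (Zspan phi f mdist e))).
apply: le_trans (lim_at_right0_ge _
  (fun e => growth_rate (Zsep phi f mdist e)) _ sep_anti e0).
apply: growth_rate_mono => T; first exact: Zspan_ge0.
by apply: Zspan_le_Zsep => [x|x y]; rewrite ?mdistxx// metric_sym.
Qed.

(** * The relaxed distances *)

Let dbar_sets_neq0 delta x y : 0 < delta ->
  [set mdist (phi s1 x) (phi s2 y) | s1 in `[0, delta[ & s2 in `[0, delta[]
    !=set0.
Proof.
move=> d0; exists (mdist (phi 0 x) (phi 0 y)).
by exists 0; [rewrite /= in_itv/= lexx|exists 0; rewrite //= in_itv/= lexx].
Qed.

Lemma dbar_le delta x y s1 s2 :
  s1 \in `[0, delta[ -> s2 \in `[0, delta[ ->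
  dbar phi delta x y <= mdist (phi s1 x) (phi s2 y).
Proof.
move=> s1d s2d; apply: ge_inf; last by exists s1 => //; exists s2.
by exists 0 => _ [? _ [? _ <-]]; exact: mdist_ge0.
Qed.

Lemma dhat_le delta x y s :
  s \in `[0, delta[ -> dhat phi delta x y <= mdist (phi s x) (phi s y).
Proof.
move=> sd; apply: ge_inf; last by exists s.
by exists 0 => _ [? _ <-]; exact: mdist_ge0.
Qed.

Lemma dhat_le_mdist delta x y : 0 < delta -> dhat phi delta x y <= mdist x y.
Proof.
move=> d0; have [[phi0 _] _] := phi_semiflow.
by rewrite -{2}(phi0 x) -{2}(phi0 y) dhat_le// in_itv/= lexx.
Qed.

Lemma dbar_le_dhat delta x y :
  0 < delta -> dbar phi delta x y <= dhat phi delta x y.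
Proof.
move=> d0; apply: lb_le_inf => [|_ [s sd <-]]; last exact: dbar_le.
by exists (mdist (phi 0 x) (phi 0 y)), 0 => //=; rewrite in_itv/= lexx.
Qed.

Lemma dhat_antitone delta delta' x y : 0 < delta -> delta <= delta' ->
  dhat phi delta' x y <= dhat phi delta x y.
Proof.
move=> d0 dd'; apply: lb_le_inf => [|_ [s sd <-]].
  by exists (mdist (phi 0 x) (phi 0 y)), 0 => //=; rewrite in_itv/= lexx.
by apply: dhat_le; apply: subset_itvl sd; rewrite bnd_simp.
Qed.

Lemma dbar_antitone delta delta' x y : 0 < delta -> delta <= delta' ->
  dbar phi delta' x y <= dbar phi delta x y.
Proof.
move=> d0 dd'; apply: lb_le_inf => [|_ [s1 s1d [s2 s2d <-]]].
  exact: dbar_sets_neq0.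
by apply: dbar_le; [apply: subset_itvl s1d|apply: subset_itvl s2d];
  rewrite bnd_simp.
Qed.

(** Both endpoints drift by less than [eta / 2] during [[0, delta)], so the
    two times at which the orbits are compared can be moved back to 0. *)
Lemma mdist_le_dbar eta : 0 < eta -> exists2 delta, 0 < delta &
  forall x y, mdist x y <= dbar phi delta x y + eta.
Proof.
move=> eta0; have eta20 : 0 < eta / 2 by lra.
have [delta delta0 small] := displacement_small _ eta20.
exists delta => // x y; rewrite -lerBlDr; apply: lb_le_inf.
  exact: dbar_sets_neq0.
move=> _ [s1 s1d [s2 s2d <-]]; rewrite lerBlDr.
have := small s1 x; have := small s2 y.
move: s1d s2d; rewrite /= !in_itv/= => -> -> /(_ isT) + /(_ isT).
have := metric_triangle x (phi s1 x) y.
have := metric_triangle (phi s1 x) (phi s2 y) y.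
by rewrite (metric_sym (phi s2 y) y); lra.
Qed.

End Semiflow.

(* The first equality is the coincidence of the two classical pressures, whose
   common value is the classical topological pressure. *)
Theorem theorem2p2 (R : realType) (X : metricType R)
    (phi : R -> X -> X) (f : X -> R) :
  compact [set: X] ->
  continuous_semiflow phi ->
  continuous f ->
  [/\ pressure_sep phi f = pressure_span phi f,
      pressure_bar_span phi f = pressure_span phi f,
      pressure_bar_sep phi f = pressure_span phi f,
      pressure_hat_span phi f = pressure_span phi f &
      pressure_hat_sep phi f = pressure_span phi f].
Proof.
move=> cX sf cf; have sepE := pressure_sepE phi f cX sf cf.
have bar_le delta x y : 0 < delta -> dbar phi delta x y <= mdist x y.
  move=> d0; exact: le_trans (dbar_le_dhat phi delta x y d0)
    (dhat_le_mdist phi sf delta x y d0).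
have bar_ge := mdist_le_dbar phi cX sf.
have hat_ge eta : 0 < eta -> exists2 delta, 0 < delta &
    forall x y, mdist x y <= dhat phi delta x y + eta.
  move=> /bar_ge[delta d0 h]; exists delta => // x y.
  by rewrite (le_trans (h x y))// lerD2r dbar_le_dhat.
have hat_le := dhat_le_mdist phi sf.
have barP Z Z_ge0 Z_le := pressure_insensitive Z (dbar phi) Z_ge0 Z_le
  (dbar_antitone phi) bar_le bar_ge.
have hatP Z Z_ge0 Z_le := pressure_insensitive Z (dhat phi) Z_ge0 Z_le
  (dhat_antitone phi) hat_le hat_ge.
split; first exact: sepE.
- exact: (barP _ (Zspan_ge0 phi f) (Zspan_le phi f)).
- by rewrite -sepE; exact: (barP _ (Zsep_ge0 phi f) (Zsep_le phi f)).
- exact: (hatP _ (Zspan_ge0 phi f) (Zspan_le phi f)).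
- by rewrite -sepE; exact: (hatP _ (Zsep_ge0 phi f) (Zsep_le phi f)).
Qed.
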